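(* Let $R$ be a commutative finite chain ring with residue field $\mathbb{F}_q$ and nilpotency index $e$. Then for all $n\ge 1$, $$|IST_n(R)|=q^{(e-1)(2n-1)}\cdot|IST_n(\mathbb{F}_q)|,$$ where $|IST_n(\mathbb{F}_q)|=\beta_1\lambda_1^n+\beta_2\lambda_2^n$ with $$\beta_1=\frac{(q+1)+\sqrt{(q-1)(q+3)}}{q\left((q+3)+\sqrt{(q-1)(q+3)}\right)},\qquad \beta_2=\frac{(q+1)-\sqrt{(q-1)(q+3)}}{q\left((q+3)-\sqrt{(q-1)(q+3)}\right)},$$ $$\lambda_1=\frac{q(q-1)+q\sqrt{(q-1)(q+3)}}{2},\qquad \lambda_2=\frac{q(q-1)-q\sqrt{(q-1)(q+3)}}{2}.$$
   Context: A commutative finite chain ring is a finite commutative ring $R$ with identity $1\ne 0$ whose ideals are totally ordered under inclusion. It has a unique maximal ideal, which is principal, say generated by $\gamma$; the nilpotency index $e$ of $R$ is the least positive integer with $\gamma^e=0$, and the residue field is $R/\gamma R\cong\mathbb{F}_q$, a finite field with $q$ elements. For a commutative ring $R$ with identity, $U(R)$ is its group of units. For $n\ge 1$, $ST_n(R)$ is the set of $n\times n$ symmetric tridiagonal matrices over $R$, i.e. symmetric matrices whose entries outside the main diagonal, the subdiagonal and the superdiagonal are zero. $IST_n(R)=\{A\in ST_n(R):\det(A)\in U(R)\}$ (and likewise for $\mathbb{F}_q$ in place of $R$). *)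

(* Defs.v *)
From HB Require Import structures.
From mathcomp Require Import all_boot all_order all_algebra.
Set Implicit Arguments.
Unset Strict Implicit.
Unset Printing Implicit Defensive.
Import GRing.Theory Num.Theory.
Local Open Scope ring_scope.

(* [idealr R] is the type of the proper ideals of [R]; the unit ideal is
   comparable with every ideal, so it need not be mentioned. *)
Definition chain_ring (R : finComUnitRingType) : Prop :=
  forall I J : idealr R, {subset I <= J} \/ {subset J <= I}.

Definition maximal_ideal (R : finComUnitRingType) (M : idealr R) : Prop :=
  forall I : idealr R, {subset M <= I} -> I =i M.

Definition generated_by (R : finComUnitRingType) (M : idealr R) (gamma : R) :
    Prop :=
  forall x : R, x \in M <-> exists y : R, x = gamma * y.

Definition nilpotency_index (R : finComUnitRingType) (gamma : R) (e : nat) :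
    Prop :=
  [/\ (0 < e)%N, gamma ^+ e = 0 &
      forall k : nat, (0 < k)%N -> gamma ^+ k = 0 -> (e <= k)%N].

Definition residue_field (R : finComUnitRingType) (M : idealr R)
    (F : finFieldType) : Prop :=
  exists f : {rmorphism {ideal_quot M} -> F}, bijective f.

Definition ST (n : nat) (R : finComUnitRingType) : {set 'M[R]_n} :=
  [set A : 'M[R]_n | (A^T == A) &&
    [forall i : 'I_n, forall j : 'I_n,
       ((i.+1 < j)%N || (j.+1 < i)%N) ==> (A i j == 0)]].

Definition IST (n : nat) (R : finComUnitRingType) : {set 'M[R]_n} :=
  [set A in ST n R | \det A \is a GRing.unit].

Section Constants.
Variables (K : rcfType) (q : nat).

Let Q : K := q%:R.
Let s : K := Num.sqrt ((Q - 1) * (Q + 3)).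

Definition beta1 : K := ((Q + 1) + s) / (Q * ((Q + 3) + s)).
Definition beta2 : K := ((Q + 1) - s) / (Q * ((Q + 3) - s)).
Definition lambda1 : K := (Q * (Q - 1) + Q * s) / 2.
Definition lambda2 : K := (Q * (Q - 1) - Q * s) / 2.
End Constants.

(* Main.v *)
(* Peel off the first row [(a, b, 0, ..., 0)] and column of a symmetric
   tridiagonal matrix: if [d] and [d'] are the determinants of the next two
   trailing blocks, the determinant is [a d - b^2 d'].  Over a local ring with
   unit group [U] and maximal ideal [N], let [x_n] count the matrices of size
   [n] with unit determinant, and [y_n] those with nonunit determinant whose
   trailing block of size [n - 1] has unit determinant.  Then
     x_(n+1) = |R| |U| (x_n + y_n),   y_(n+1) = |R| |N| x_n.
   For a chain ring [|R| = q^e] and [|N| = q^(e-1)], so comparing with the same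
   recurrence over the residue field gives the power of [q]; over the field
   this is the linear recurrence with characteristic roots [lambda1] and
   [lambda2]. *)
Require Import Defs.
From HB Require Import structures.
From mathcomp Require Import all_boot all_order all_algebra.
From mathcomp Require Import ring lra zify.
Set Implicit Arguments.
Unset Strict Implicit.
Unset Printing Implicit Defensive.
Import GRing.Theory Num.Theory.
Local Open Scope ring_scope.

(** * Bordering a tridiagonal matrix by a first row and column *)

Definition trail (R : Type) n (A : 'M[R]_n.+1) : 'M[R]_n :=
  row' ord0 (col' ord0 A).

Definition border (R : nzRingType) n (a b : R) (B : 'M[R]_n.+1) :
    'M[R]_n.+2 :=
  \matrix_(i, j)
    match unlift ord0 i, unlift ord0 j with
    | None, None => a
    | None, Some k | Some k, None => if k == ord0 then b else 0
    | Some k, Some l => B k l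
    end.

Section Border.
Variables (R : finComUnitRingType) (n : nat).
Implicit Types (a b : R) (B : 'M[R]_n.+1).

Lemma trail_border a b B : trail (border a b B) = B.
Proof. by apply/matrixP=> i j; rewrite !mxE !liftK. Qed.

Lemma border_inj B : injective (fun ab : R * R => border ab.1 ab.2 B).
Proof.
move=> [a b] [a' b'] /matrixP eqM.
have := eqM ord0 ord0; have := eqM ord0 (lift ord0 ord0).
by rewrite !mxE unlift_none liftK /= => -> ->.
Qed.

Lemma det_border a b B :
  \det (border a b B) = a * \det B - b ^+ 2 * \det (trail B).
Proof.
rewrite (expand_det_row _ ord0) !big_ord_recl big1 => [|j _]; last first.
  by rewrite mxE unlift_none liftK /= mul0r.
rewrite !mxE unlift_none liftK /= addr0 /cofactor.
have -> : row' ord0 (col' ord0 (border a b B)) = B by exact: trail_border.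
(* The minor [C] omits row 0 and column 1, so its first column is [(b, 0, ..., 0)]; expanding along
   it gives the second factor [b]. *)
set C := row' _ _; rewrite (expand_det_col (C : 'M_n.+1) ord0) big_ord_recl.
rewrite big1 => [|i _]; last first.
  rewrite !mxE liftK (_ : lift (lift ord0 ord0) ord0 = ord0); last exact/val_inj.
  by rewrite unlift_none /= mul0r.
rewrite !mxE liftK (_ : lift (lift ord0 ord0) ord0 = ord0); last exact/val_inj.
rewrite unlift_none /cofactor /= /bump /= !addn0 !expr0 expr1 !mul1r addr0.
have -> : row' ord0 (col' ord0 (C : 'M_n.+1)) = trail B; last by ring.
apply/matrixP=> i j; rewrite !mxE.
have -> : lift (lift ord0 ord0) (lift ord0 j) = lift ord0 (lift ord0 j)
  by exact/val_inj.
by rewrite !liftK.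
Qed.

Lemma border_ST a b B : (border a b B \in ST n.+2 R) = (B \in ST n.+1 R).
Proof.
rewrite !inE; apply/andP/andP=> -[/eqP/matrixP sym /forallP band]; split.
- apply/eqP/matrixP=> i j; have := sym (lift ord0 i) (lift ord0 j).
  by rewrite !mxE !liftK.
- apply/forallP=> i; apply/forallP=> j.
  by have /forallP/(_ (lift ord0 j)) := band (lift ord0 i); rewrite !mxE !liftK.
- apply/eqP/matrixP=> i j; rewrite !mxE.
  case: (unliftP ord0 i) => [k|] _; case: (unliftP ord0 j) => [l|] _ //.
  by rewrite -sym mxE.
- apply/forallP=> i; apply/forallP=> j; rewrite !mxE.
  case: (unliftP ord0 i) => [k|] ->; case: (unliftP ord0 j) => [l|] -> //.
  + by have /forallP/(_ l) := band k.
  + by case: ifP => [/eqP ->|_]; rewrite ?eqxx ?implybT.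
  + by case: ifP => [/eqP ->|_]; rewrite ?eqxx ?implybT.
Qed.

Lemma border_trail (A : 'M[R]_n.+2) : A \in ST n.+2 R ->
  A = border (A ord0 ord0) (A ord0 (lift ord0 ord0)) (trail A).
Proof.
rewrite inE => /andP[/eqP/matrixP sym /forallP band].
have zero (k : 'I_n.+1) : k != ord0 -> A ord0 (lift ord0 k) = 0.
  move=> k0; have /forallP/(_ (lift ord0 k))/implyP/(_ _)/eqP -> // := band ord0.
  by rewrite /= /bump /= add1n ltnS lt0n (inj_eq val_inj k ord0) k0.
apply/matrixP=> i j; rewrite !mxE.
case: (unliftP ord0 i) => [k|] ->; case: (unliftP ord0 j) => [l|] -> //.
- by rewrite !mxE.
- rewrite -sym mxE; case: eqP => [-> //|/eqP]; exact: zero.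
- case: eqP => [-> //|/eqP]; exact: zero.
Qed.

(** Group the matrices by trailing block: by [border_trail] and [border_inj], the fibre over [B] is
    parametrised by the pairs [(a, b)]. *)
Lemma card_ST_border (P : pred 'M[R]_n.+2) :
  #|[set A in ST n.+2 R | P A]| =
  (\sum_(B in ST n.+1 R) #|[set ab : R * R | P (border ab.1 ab.2 B)]|)%N.
Proof.
rewrite -sum1_card (partition_big (@trail R n.+1) (mem (ST n.+1 R))); last first.
  move=> A; rewrite inE => /andP[AST _].
  by rewrite /= -(border_ST (A ord0 ord0) (A ord0 (lift ord0 ord0))) -border_trail.
apply: eq_bigr => B BST; rewrite sum1_card -(card_imset _ (@border_inj B)).
apply: eq_card => A; rewrite unfold_in [A \in [set A0 in _ | _]]inE.
apply/andP/imsetP => [[/andP[AST PA] /eqP trA]|[[a b]]].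
  exists (A ord0 ord0, A ord0 (lift ord0 ord0)); last first.
    by rewrite /= -trA -border_trail.
  by rewrite inE /= -trA -border_trail.
rewrite inE /= => Pab ->; rewrite trail_border Pab andbT border_ST eqxx.
by split.
Qed.

End Border.

(** As [u] is invertible, [b] and the value [a u - b^2 v] can be prescribed freely and determine
    [a]. *)
Lemma card_affine_pairs (R : finComUnitRingType) (P : pred R) (u v : R) :
  u \is a GRing.unit ->
  #|[set ab : R * R | P (ab.1 * u - ab.2 ^+ 2 * v)]| = (#|R| * #|P|)%N.
Proof.
move=> uU; pose f (ab : R * R) := (ab.2, ab.1 * u - ab.2 ^+ 2 * v).
have fI : injective f.
  by move=> [a b] [a' b'] [-> /addIr /(mulIr uU) ->].
rewrite -(card_imset _ fI) -cardX; apply: eq_card => -[b c].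
rewrite [RHS]inE /=; apply/imsetP/idP => [[ab]|Pc].
  by rewrite inE => Pab [_ ->].
exists ((c + b ^+ 2 * v) / u, b); last by rewrite /f /= divrK // addrK.
by rewrite inE /= divrK // addrK.
Qed.

(* In a local ring the unit pattern of [\det A] and [\det (trail A)] evolves
   like a two-state chain; [semi_IST] is the state besides [IST] from which
   [IST] can be reached. *)
Definition semi_IST (n : nat) (R : finComUnitRingType) : {set 'M[R]_n.+1} :=
  [set A in ST n.+1 R | (\det A \isn't a GRing.unit) &&
                        (\det (trail A) \is a GRing.unit)].

(** * Recurrences over a local ring *)

Section LocalRing.
Variable R : finComUnitRingType.
Hypothesis nonunitB : forall x y : R, x \isn't a GRing.unit ->
  y \isn't a GRing.unit -> x - y \isn't a GRing.unit.

Let U := #|[pred x : R | x \is a GRing.unit]|.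
Let N := #|[pred x : R | x \isn't a GRing.unit]|.

(** Modulo the maximal ideal the term [a u] vanishes, so [a] is free and only [b^2 v] decides. *)
Lemma card_unit_pairs_nonunit (u v : R) : u \isn't a GRing.unit ->
  #|[set ab : R * R | ab.1 * u - ab.2 ^+ 2 * v \is a GRing.unit]| =
  (if v \is a GRing.unit then #|R| * U else 0)%N.
Proof.
move=> uN.
have unitE a b : (a * u - b ^+ 2 * v \is a GRing.unit) =
    (b \is a GRing.unit) && (v \is a GRing.unit).
  have auN : a * u \isn't a GRing.unit by rewrite unitrM negb_and uN orbT.
  have -> : (b \is a GRing.unit) && (v \is a GRing.unit) =
      (b ^+ 2 * v \is a GRing.unit) by rewrite unitrM unitrX_pos.
  apply/idP/idP; apply: contraLR => hN; first exact: nonunitB.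
  by have := nonunitB auN hN; rewrite subKr.
case: ifP => vU.
  rewrite -cardX; apply: eq_card => -[a b].
  by rewrite !inE /= unitE vU andbT.
by apply: eq_card0 => -[a b]; rewrite !inE /= unitE vU andbF.
Qed.

Lemma card_IST_rec n :
  #|IST n.+2 R| = (#|R| * U * (#|IST n.+1 R| + #|semi_IST n R|))%N.
Proof.
rewrite {1}/IST card_ST_border mulnDr -[#|IST _ _|]sum1_card.
rewrite -[#|semi_IST _ _|]sum1_card !big_distrr /=.
(* Blocks with unit determinant give the [IST] term; among the others, only those in [semi_IST]
   contribute. *)
rewrite (bigID (fun B : 'M_n.+1 => \det B \is a GRing.unit)) /=; congr addn.
  rewrite [RHS](eq_bigl (fun B => (B \in ST n.+1 R) &&
    (\det B \is a GRing.unit))) => [|B]; last by rewrite inE.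
  apply: eq_bigr => B /andP[_ BU]; rewrite muln1.
  rewrite -(card_affine_pairs [pred x | x \is a GRing.unit] (\det (trail B)) BU).
  by apply: eq_card => ab; rewrite !inE det_border.
rewrite [RHS](eq_bigl (fun B => ((B \in ST n.+1 R) &&
    (\det B \isn't a GRing.unit)) && (\det (trail B) \is a GRing.unit)));
  last by move=> B; rewrite !inE andbA.
rewrite [RHS]big_mkcondr; apply: eq_bigr => B /andP[_ BN].
rewrite muln1 -(card_unit_pairs_nonunit (\det (trail B)) BN).
by apply: eq_card => ab; rewrite !inE det_border.
Qed.

Lemma card_semi_IST_rec n : #|semi_IST n.+1 R| = (#|R| * N * #|IST n.+1 R|)%N.
Proof.
rewrite /semi_IST card_ST_border -[#|IST _ _|]sum1_card big_distrr /=.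
rewrite [RHS](eq_bigl (fun B => (B \in ST n.+1 R) &&
    (\det B \is a GRing.unit))) => [|B]; last by rewrite inE.
rewrite [RHS]big_mkcondr /=; apply: eq_bigr => B _.
under eq_finset => ab do rewrite trail_border det_border.
case: ifP => BU; last by apply: eq_card0 => ab; rewrite !inE andbF.
rewrite muln1.
rewrite -(card_affine_pairs [pred x | x \isn't a GRing.unit] (\det (trail B)) BU).
by apply: eq_card => ab; rewrite !inE andbT.
Qed.

Lemma card_ST1 (P : pred R) : #|[set A in ST 1 R | P (\det A)]| = #|P|.
Proof.
have inj : injective (fun a : R => a%:M : 'M_1).
  by move=> a b /matrixP/(_ ord0 ord0); rewrite !mxE eqxx.
rewrite -(card_imset _ inj); apply: eq_card => A; rewrite !inE.
rewrite {1}[A]mx11_scalar tr_scalar_mx -mx11_scalar eqxx det_mx11 /=.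
have -> /= : [forall i : 'I_1, forall j : 'I_1,
    ((i.+1 < j) || (j.+1 < i))%N ==> (A i j == 0)].
  by apply/forallP=> i; apply/forallP=> j; rewrite !ord1.
apply/idP/imsetP => [PA|[a Pa ->]]; last by rewrite mxE.
by exists (A ord0 ord0); rewrite // -mx11_scalar.
Qed.

Lemma card_IST1 : #|IST 1 R| = U.
Proof. exact: card_ST1. Qed.

(** The trailing block is empty, with determinant 1, so only the single entry is constrained. *)
Lemma card_semi_IST0 : #|semi_IST 0 R| = N.
Proof.
rewrite /N -(card_ST1 [pred x | x \isn't a GRing.unit]); apply: eq_card => A.
by rewrite !inE det_mx00 unitr1 andbT.
Qed.

End LocalRing.

(** * Orders of a chain ring, its unit group and its maximal ideal *)

Section ResidueMap.
Variables (R : finComUnitRingType) (F : finFieldType) (f : {rmorphism R -> F}).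
Variables (gamma : R) (e : nat).
Hypothesis f_surj : forall y, exists x, f x = y.
Hypothesis f_ker : forall x, f x = 0 <-> exists y, x = gamma * y.
Hypothesis gamma_nil : nilpotency_index gamma e.

Lemma unit_residueE (x : R) : (x \is a GRing.unit) = (f x != 0).
Proof.
case: gamma_nil => _ gamma0 _; apply/idP/idP => [xU|fx0].
  by rewrite -unitfE rmorph_unit.
have [t ft] := f_surj (f x)^-1.
have [y zE] : exists y, 1 - x * t = gamma * y.
  by apply/f_ker; rewrite rmorphB rmorphM rmorph1 ft divff // subrr.
suff : x * t \is a GRing.unit by rewrite unitrM => /andP[].
have -> : x * t = 1 - gamma * y by rewrite -zE; ring.
(* The geometric series inverts [1 - gamma * y], since [gamma * y] is nilpotent. *)
apply/unitrPr; exists (\sum_(i < e) (gamma * y) ^+ i).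
apply: oppr_inj; rewrite -mulNr opprB -subrX1 exprMn gamma0 mul0r.
by rewrite sub0r.
Qed.

Lemma nonunit_residueB (x y : R) : x \isn't a GRing.unit ->
  y \isn't a GRing.unit -> x - y \isn't a GRing.unit.
Proof.
rewrite !unit_residueE !negbK rmorphB => /eqP-> /eqP->.
by rewrite subrr.
Qed.

(** The powers of the maximal ideal, descending from [J 0 = R] to [J e = 0]. *)
Let J i := [set gamma ^+ i * x | x : R].

(** With [t] choosing a preimage of each residue, every element of [J i] is uniquely
    [gamma ^+ i * t a] plus an element of [J i.+1]. *)
Lemma card_gammaX_step i : (i < e)%N -> #|J i| = (#|F| * #|J i.+1|)%N.
Proof.
case: gamma_nil => e0 gamma0 gamma_min ltie.
have gammai0 : gamma ^+ i != 0.
  apply: contraTneq ltie => gi0; rewrite -leqNgt.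
  (* Minimality of [e] concerns positive exponents; exponent 0 is excluded by [1 != 0]. *)
  case: i gi0 => [|i] gi0; last exact: gamma_min.
  by have := oner_neq0 R; rewrite -[1](expr0 gamma) gi0 eqxx.
have repP (a : F) : exists x, f x == a.
  by have [x <-] := f_surj a; exists x.
pose t a := xchoose (repP a).
have tK a : f (t a) = a by apply/eqP; exact: (xchooseP (repP a)).
pose g (p : F * R) := gamma ^+ i * t p.1 + p.2.
have gI : {in setX [set: F] (J i.+1) &, injective g}.
  move=> [a x] [b y]; rewrite !inE /= => /imsetP[u _ ->] /imsetP[v _ ->].
  rewrite /g /= => eqg.
  suff ab : a = b by move: eqg; rewrite ab => /addrI ->.
  apply/eqP; rewrite -subr_eq0; apply: contraNT gammai0 => ab.
  (* This element has residue [a - b], and [eqg] says that [gamma ^+ i] times it is zero; being a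
     unit, it would force [gamma ^+ i = 0]. *)
  have wU : t a - t b - gamma * (v - u) \is a GRing.unit.
    rewrite unit_residueE rmorphB (_ : f (gamma * _) = 0); last first.
      by apply/f_ker; exists (v - u).
    by rewrite subr0 rmorphB !tK.
  rewrite -(inj_eq (mulIr wU)) mul0r exprS in eqg *.
  apply/eqP; transitivity ((gamma ^+ i * t a + gamma * gamma ^+ i * u) -
    (gamma ^+ i * t b + gamma * gamma ^+ i * v)); first by ring.
  by rewrite eqg subrr.
rewrite -cardsT -cardsX -(card_in_imset gI); apply: eq_card => z.
apply/imsetP/imsetP => [[x _ ->]|[[a x]]].
  have [y yE] : exists y, x - t (f x) = gamma * y.
    by apply/f_ker; rewrite rmorphB tK subrr.
  exists (f x, gamma ^+ i.+1 * y); first by rewrite inE in_setT; apply/imsetP; exists y.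
  by rewrite /g /= exprSr -mulrA -yE -mulrDr addrC subrK.
rewrite !inE /= => /imsetP[u _ ->] ->.
by exists (t a + gamma * u); rewrite // /g /= exprSr; ring.
Qed.

Lemma card_gammaX k : (k <= e)%N -> #|J (e - k)| = (#|F| ^ k)%N.
Proof.
case: gamma_nil => _ gamma0 _.
elim: k => [_|k IH ltke].
  rewrite subn0 (_ : J e = [set 0]) ?cards1 //.
  apply/setP=> x; rewrite inE; apply/imsetP/eqP => [[y _ ->]|->].
    by rewrite gamma0 mul0r.
  by exists 0; rewrite ?mulr0.
rewrite card_gammaX_step; last lia.
by rewrite subnSK // IH ?expnS // ltnW.
Qed.

Lemma card_chain_ring : #|R| = (#|F| ^ e)%N.
Proof.
rewrite -card_gammaX // subnn -cardsT; apply: eq_card => x.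
by rewrite inE; apply/esym/imsetP; exists x; rewrite // mul1r.
Qed.

Lemma card_nonunits :
  #|[pred x : R | x \isn't a GRing.unit]| = (#|F| ^ e.-1)%N.
Proof.
case: (gamma_nil) => e0 _ _.
rewrite -card_gammaX ?leq_pred // (_ : e - e.-1 = 1)%N; last lia.
apply: eq_card => x; rewrite !inE unit_residueE negbK.
apply/eqP/imsetP => [/f_ker[y ->]|[y _ ->]]; first by exists y.
by apply/f_ker; exists y.
Qed.

Lemma card_units :
  #|[pred x : R | x \is a GRing.unit]| = (#|F| ^ e.-1 * #|F|.-1)%N.
Proof.
case: (gamma_nil) => e0 _ _.
have := cardC [pred x : R | x \is a GRing.unit].
have -> : #|[predC [pred x : R | x \is a GRing.unit]]| = (#|F| ^ e.-1)%N.
  by rewrite -card_nonunits; apply: eq_card.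
rewrite card_chain_ring -{2}(prednK e0) expnS.
rewrite -{2}(prednK (ltnW (card_finNzRing_gt1 F))) mulSn addnC => /addnI ->.
exact: mulnC.
Qed.

End ResidueMap.

(** * The closed form over a finite field *)

Section FiniteField.
Variable F : finFieldType.

Lemma field_nonunitB (x y : F) : x \isn't a GRing.unit ->
  y \isn't a GRing.unit -> x - y \isn't a GRing.unit.
Proof. by rewrite !unitfE !negbK => /eqP-> /eqP->; rewrite subrr. Qed.

Lemma card_field_units : #|[pred x : F | x \is a GRing.unit]| = #|F|.-1.
Proof.
rewrite (cardD1 (0 : F) F) add1n /=; apply: eq_card => x.
by rewrite !inE unitfE andbT.
Qed.

Lemma card_field_nonunits : #|[pred x : F | x \isn't a GRing.unit]| = 1%N.
Proof.
apply: (etrans _ (card1 (0 : F))); apply: eq_card => x.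
by rewrite !inE unitfE negbK.
Qed.

(* The initial value [#|semi_IST 0 F| = 1] fits the pattern [q * x_n] with
   [x_0 = beta1 + beta2 = 1 / q], which is not the number of invertible
   [0 x 0] matrices. *)
Lemma card_IST_semi_IST_closed_form (K : rcfType) n :
  let q := #|F| in
  #|IST n.+1 F|%:R = beta1 K q * lambda1 K q ^+ n.+1
                   + beta2 K q * lambda2 K q ^+ n.+1 /\
  #|semi_IST n F|%:R = q%:R * (beta1 K q * lambda1 K q ^+ n
                             + beta2 K q * lambda2 K q ^+ n).
Proof.
set q := #|F|; have q1 : (1 < q)%N := card_finNzRing_gt1 F.
have q1E : q.-1%:R = q%:R - 1 :> K by rewrite -subn1 natrB // ltnW.
rewrite /beta1 /beta2 /lambda1 /lambda2 /=.
set Q : K := q%:R in q1E *; set s := Num.sqrt _.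
have Q1 : 1 < Q by rewrite ltr1n.
have sE : s ^+ 2 = (Q - 1) * (Q + 3) by rewrite sqr_sqrtr //; nra.
have s0 : 0 <= s by exact: sqrtr_ge0.
have Q0 : Q != 0 by apply: lt0r_neq0; lra.
have dp : Q + 3 + s != 0 by apply: lt0r_neq0; lra.
(* Here [s < Q + 3] because [s ^+ 2 = (Q - 1) * (Q + 3)]. *)
have dm : Q + 3 - s != 0 by apply: lt0r_neq0; nra.
set l1 := _ / 2; set l2 := _ / 2; set b1 := (_ / _); set b2 := (_ / _).
(* Eliminating [y_n] gives [x_(n+2) = Q (Q - 1) (x_(n+1) + Q x_n)], whose characteristic equation
   this is. *)
have l1E : l1 ^+ 2 = Q * (Q - 1) * (l1 + Q) by rewrite /l1; field: sE.
have l2E : l2 ^+ 2 = Q * (Q - 1) * (l2 + Q) by rewrite /l2; field: sE.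
have base0 : Q * (b1 + b2) = 1.
  rewrite /b1 /b2; field: sE; by rewrite Q0 dp dm.
have base1 : b1 * l1 + b2 * l2 = Q - 1.
  rewrite /b1 /b2 /l1 /l2; field: sE; by rewrite Q0 dp dm.
elim: n => [|n [IHx IHy]].
  rewrite card_IST1 card_field_units card_semi_IST0 card_field_nonunits.
  by rewrite !expr0 !mulr1 base0 !expr1 base1.
split.
  rewrite (card_IST_rec field_nonunitB) card_field_units !natrM natrD q1E IHx IHy.
  rewrite -/q -/Q [l1 ^+ n.+2](exprD _ 2 n) [l2 ^+ n.+2](exprD _ 2 n) l1E l2E.
  by rewrite !exprS; ring.
rewrite card_semi_IST_rec card_field_nonunits muln1 natrM IHx -/q -/Q.
by [].
Qed.

End FiniteField.

Theorem theorem3p3 (R : finComUnitRingType) (M : idealr R) (gamma : R)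
    (e : nat) (F : finFieldType) (K : rcfType) (n : nat)
    (R_chain : chain_ring R) (M_max : maximal_ideal M)
    (M_gen : generated_by M gamma) (gamma_nil : nilpotency_index gamma e)
    (F_res : residue_field M F) (n_ge1 : (1 <= n)%N) :
  #|IST n R| = (#|F| ^ ((e - 1) * (2 * n - 1)) * #|IST n F|)%N /\
  #|IST n F|%:R = beta1 K #|F| * lambda1 K #|F| ^+ n
                  + beta2 K #|F| * lambda2 K #|F| ^+ n :> K.
Proof.
case: n n_ge1 => // n _; split; last exact: (card_IST_semi_IST_closed_form F K n).1.
case: F_res => g [h gK hK].
pose f : {rmorphism R -> F} := (g \o \pi_{ideal_quot M}%qT).
have f_surj y : exists x, f x = y.
  by exists (repr (h y)); rewrite /f /= reprK hK.
have f_ker x : f x = 0 <-> exists y, x = gamma * y.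
  (* Since [g] is injective, the kernel of [f] is that of the projection, namely [M]. *)
  rewrite -M_gen -[x in x \in M]subr0 Quotient.idealrBE /f /=.
  split=> [gx0|/eqP ->]; last by rewrite !rmorph0.
  by apply/eqP; apply: (can_inj gK); rewrite gx0 !rmorph0.
have nonunitB := nonunit_residueB f_surj f_ker gamma_nil.
have cardR := card_chain_ring f_surj f_ker gamma_nil.
have cardU := card_units f_surj f_ker gamma_nil.
have cardN := card_nonunits f_surj f_ker gamma_nil.
have e0 : (0 < e)%N by case: gamma_nil.
rewrite subn1 -(prednK e0) expnS in cardR cardU cardN *.
move: cardR cardU cardN; set m := (#|F| ^ e.-1)%N => cardR cardU cardN.
rewrite expnM -/m.
(* The ring, its units and its nonunits are each [m] times as many as over [F]. Size 1 gives one
   factor [m] and each recurrence step two more, hence the exponent [2n + 1] at size [n + 1]. *)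
suff /(_ n)[] : forall n,
  #|IST n.+1 R| = (m ^ n.*2.+1 * #|IST n.+1 F|)%N /\
  #|semi_IST n R| = (m ^ n.*2.+1 * #|semi_IST n F|)%N.
  by move=> -> _; congr (_ ^ _ * _)%N; lia.
elim=> [|k [IHx IHy]].
  rewrite !card_IST1 !card_semi_IST0 card_field_units card_field_nonunits.
  by rewrite expn1 muln1.
rewrite !card_semi_IST_rec (card_IST_rec nonunitB) (card_IST_rec (@field_nonunitB F)).
rewrite cardR cardU cardN card_field_units card_field_nonunits IHx IHy.
by rewrite doubleS !expnS; split; ring.
Qed.
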